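(* Let $c$ be a constant and consider the Monge–Ampère equation $$c\,x\,\exp\left[-8\,\partial_\omega\mathcal{G}-4\,\partial_x\mathcal{G}\right]-\left(\partial_x\partial_\omega\mathcal{G}\right)^2+\partial_\omega^2\mathcal{G}\;\partial_x^2\mathcal{G}=0$$ for $\mathcal{G}=\mathcal{G}(x,\omega)$. Look for solutions in the form of a series expansion with a logarithmic singularity at $\omega=0$, $$\mathcal{G}(x,\omega)=\frac18\,\omega\log\omega+\mathcal{G}_0(x)+\sum_{k=1}^\infty\omega^k\,\mathcal{G}_k(x).$$ Then the function $\mathcal{G}_0(x)$ is free (the equation imposes no condition on it), and all the functions $\mathcal{G}_k(x)$ with $k\ge1$ are determined in terms of $\mathcal{G}_0(x)$.
   Context: The expansion is substituted in the equation, which is imposed order by order in $\omega$; here $\exp[-8\,\partial_\omega(\tfrac18\omega\log\omega)]=\frac{1}{e\,\omega}$ and $\partial_\omega^2(\tfrac18\omega\log\omega)=\frac1{8\omega}$. The equation is the Ricci-flatness condition for the (non-universal part of the) symplectic potential of a toric Kähler metric with isometry group $\mathrm{SU}(2)\times\mathrm{U}(1)\times\mathrm{U}(1)$ on the total space of the canonical bundle of a compact complex surface, where $\omega=0$ is the exceptional divisor and $\mathcal{G}_0$ encodes the Kähler metric on it.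
   Formalization: The constant c is taken nonzero, and G_0 (real, smooth) is free only subject to c x G_0'' < 0, which the order 1/ω forces for real solutions at x ≠ 0; for c = 0, or for G_0 = 0 with c ≠ 0, the claim as worded fails. *)

(* Defs.v *)
From Stdlib Require Import Reals.
From Coquelicot Require Import Coquelicot.
Open Scope R_scope.

Definition d_x (F : R -> R -> R) : R -> R -> R :=
  fun x w => Derive (fun t => F t w) x.

Definition d_w (F : R -> R -> R) : R -> R -> R :=
  fun x w => Derive (fun s => F x s) w.

Definition monge_ampere (c : R) (F : R -> R -> R) (x w : R) : R :=
  c * x * exp (- 8 * d_w F x w - 4 * d_x F x w)
  - (d_x (d_w F) x w) ^ 2
  + d_w (d_w F) x w * d_x (d_x F) x w.

(* The series is formal (no convergence is assumed); only its truncations are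
   honest functions, on [0 < w]. *)
Definition log_series_trunc (G : nat -> R -> R) (N : nat) (x w : R) : R :=
  / 8 * w * ln w + G 0%nat x + sum_n_m (fun k => w ^ k * G k x) 1 N.

Definition smooth_on (U : R -> Prop) (f : R -> R) : Prop :=
  forall (n : nat) (x : R), U x -> ex_derive_n f n x.

(* The equation holds order by order in [w]: up to any prescribed order [m],
   substituting the series, truncated far enough, leaves a remainder
   [o(w ^ m)] as [w -> 0+].  The coefficient of a given power of [w] involves
   only finitely many [G k], so late truncations all have the same one.  The
   expansion of the left-hand side starts at order [w ^ (-1)]; since the
   remainder is [o(w ^ m)] for every natural [m], that order vanishes too. *)
Definition solves_order_by_order
    (c : R) (U : R -> Prop) (G : nat -> R -> R) : Prop :=
  forall (m : nat) (x : R), U x ->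
    eventually (fun N =>
      filterlim (fun w => monge_ampere c (log_series_trunc G N) x w / w ^ m)
        (at_right 0) (locally 0)).

Definition log_series_solution
    (c : R) (U : R -> Prop) (G : nat -> R -> R) : Prop :=
  (forall k : nat, smooth_on U (G k)) /\ solves_order_by_order c U G.

(* Main.v *)
Require Import Defs.
From Stdlib Require Import Reals Lra Lia Wf_nat.
From Coquelicot Require Import Coquelicot.
Open Scope R_scope.

(** Fix [x] and write [a k = G k x], [b k = (G k)' x], [d k = (G k)'' x].  For
    [A = sum (k+1) a_(k+1) w^k], [B = sum b_k w^k] and [D = sum d_k w^k], with
    all sequences cut at order [N], substituting the truncated series and
    multiplying by [w] turns the equation into [K exp P = Q], where
    [K = c x / e], [P = - 8 A - 4 B] and
    [Q = w (B')^2 - (1/8 + w A') D] are polynomials in [w]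
    ([monge_ampere_trunc]).

    The exponential is removed by a logarithmic derivative: [K exp P - Q]
    vanishes to a given order at [w = 0] if and only if [K exp P = Q] holds at
    [w = 0] and [Q' - P' Q] vanishes to one order less
    ([lim_exp_minus_series_iff]).  Cutting at a late [N] does not change the low
    coefficients of [Q' - P' Q], so the equation holds order by order if and
    only if [K exp (- 8 a_1 - 4 b_0) = - d_0 / 8] and all the coefficients of
    [Q' - P' Q] are zero ([solves_order_by_order_iff]).

    The first relation determines [a_1].  The [n]-th coefficient of [Q' - P' Q]
    is affine in [a_(n+2)], with slope [- (n+1) (n+2)^2 d_0], and apart from that
    involves the [G k] with [k <= n+1] only ([residual_diff_top]).  Where
    [d_0 <> 0], the relations therefore determine [G 1], [G 2], and so on, one
    after the other.

    For existence, the sign condition says that [- d_0 / (8 c x)] is positive,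
    so [G 1] can be defined by a logarithm, and the later [G k] by dividing by
    [G0'']; all of them are smooth because the formulas are built from smooth
    functions, inverses and logarithms ([smooth_expr]).  For uniqueness, the
    first relation forces [d_0 <> 0] as soon as [x <> 0]; the coefficients at
    [x = 0], where the relations degenerate, follow by continuity. *)

(** * Everywhere convergent power series *)

Definition entire (a : nat -> R) : Prop := forall w : R, ex_pseries a w.

Lemma entire_CV_radius (a : nat -> R) (w : R) :
  entire a -> Rbar_lt (Rabs w) (CV_radius a).
Proof.
  intros Ha.
  apply Rbar_lt_le_trans with (Finite (Rabs (Rabs w + 1))).
  - simpl. pose proof (Rabs_pos w).
    rewrite (Rabs_pos_eq (Rabs w + 1)); lra.
  - apply Rbar_not_lt_le. intros Hlt.
    apply (CV_disk_outside _ _ Hlt).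
    apply ex_series_lim_0.
    apply ex_series_ext with (2 := Ha (Rabs w + 1)).
    intros n. rewrite pow_n_pow. apply Rmult_comm.
Qed.

Lemma entire_finite (a : nat -> R) (N : nat) :
  (forall k, (N < k)%nat -> a k = 0) -> entire a.
Proof.
  intros Ha w.
  apply (ex_series_incr_n _ (S N)).
  exists 0.
  apply is_series_ext with (fun _ : nat => 0).
  - intros n. rewrite Ha by lia. symmetry. apply (scal_zero_r (V := R_NormedModule)).
  - apply filterlim_ext with (fun _ : nat => 0).
    + intros n. symmetry. rewrite sum_n_const. ring.
    + apply filterlim_const.
Qed.

Lemma PSeries_finite (a : nat -> R) (N : nat) (w : R) :
  (forall k, (N < k)%nat -> a k = 0) ->
  PSeries a w = sum_n (fun k => a k * w ^ k) N.
Proof.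
  intros Ha. rewrite (PSeries_decr_n a N) by exact (entire_finite a N Ha w).
  rewrite <- sum_n_Reals.
  rewrite (PSeries_ext _ (fun _ => 0)), PSeries_const_0.
  - ring.
  - intros k. unfold PS_decr_n. apply Ha. lia.
Qed.

Lemma entire_derive (a : nat -> R) : entire a -> entire (PS_derive a).
Proof. intros Ha w. apply ex_pseries_derive, entire_CV_radius, Ha. Qed.

Lemma entire_mult (a b : nat -> R) :
  entire a -> entire b -> entire (PS_mult a b).
Proof.
  intros Ha Hb w. apply ex_pseries_mult; now apply entire_CV_radius.
Qed.

Lemma entire_minus (a b : nat -> R) :
  entire a -> entire b -> entire (PS_minus a b).
Proof. intros Ha Hb w. now apply ex_pseries_minus. Qed.

Lemma entire_plus (a b : nat -> R) :
  entire a -> entire b -> entire (PS_plus a b).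
Proof. intros Ha Hb w. now apply ex_pseries_plus. Qed.

Lemma entire_scal (r : R) (a : nat -> R) : entire a -> entire (PS_scal r a).
Proof. intros Ha w. apply ex_pseries_scal; [apply Rmult_comm | apply Ha]. Qed.

Lemma entire_incr_1 (a : nat -> R) : entire a -> entire (PS_incr_1 a).
Proof. intros Ha w. now apply ex_pseries_incr_1. Qed.

Lemma entire_decr_n (a : nat -> R) (n : nat) :
  entire a -> entire (PS_decr_n a n).
Proof.
  intros Ha. induction n as [|n IH].
  - exact Ha.
  - intros w. assert (H : entire (PS_decr_1 (PS_decr_n a n))).
    { intros v. apply CV_radius_inside. rewrite CV_radius_decr_1.
      now apply entire_CV_radius. }
    apply ex_series_ext with (2 := H w).
    intros k. unfold PS_decr_1, PS_decr_n.
    now replace (S n + k)%nat with (n + S k)%nat by lia.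
Qed.

Lemma is_derive_entire (a : nat -> R) (w : R) :
  entire a -> is_derive (PSeries a) w (PSeries (PS_derive a) w).
Proof. intros Ha. now apply is_derive_PSeries, entire_CV_radius. Qed.

Lemma entire_continuous (a : nat -> R) (w : R) :
  entire a -> continuous (PSeries a) w.
Proof.
  intros Ha. apply continuity_pt_filterlim, PSeries_continuity.
  now apply entire_CV_radius.
Qed.

Lemma filterlim_at_right_continuous (g : R -> R) (a : R) :
  continuous g a -> filterlim g (at_right a) (locally (g a)).
Proof.
  intros Hg. apply filterlim_filter_le_1 with (2 := Hg), filter_le_within.
Qed.

Lemma at_right_unique (f : R -> R) (a l l' : R) :
  filterlim f (at_right a) (locally l) ->
  filterlim f (at_right a) (locally l') -> l = l'.
Proof.
  apply (filterlim_locally_unique (F := at_right a) (V := R_NormedModule)).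
Qed.

(** * Order of vanishing *)

(** The mean value theorem is applied to [D w - g 0 / (m+1) * w ^ (m+1)], whose
    derivative is [w ^ m * (g w - g 0)]. *)
Lemma lim_quotient_of_derivative (D g : R -> R) (m : nat) :
  D 0 = 0 -> (forall w, is_derive D w (w ^ m * g w)) -> continuous g 0 ->
  filterlim (fun w => D w / w ^ S m) (at_right 0)
    (locally (g 0 / INR (S m))).
Proof.
  intros D0 HD Hg.
  assert (Hm : INR (S m) <> 0) by now apply not_0_INR.
  apply filterlim_locally. intros eps.
  assert (He : 0 < eps / 2) by (pose proof (cond_pos eps); lra).
  destruct (proj1 (filterlim_locally g (g 0)) Hg (mkposreal _ He)) as [del Hdel].
  exists del. intros w Hw Hw0.
  change (Rabs (D w / w ^ S m - g 0 / INR (S m)) < eps).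
  assert (Hwd : w < del).
  { apply Rabs_lt_between in Hw. unfold minus, plus, opp in Hw. simpl in Hw. lra. }
  (* Subtracting the leading term leaves [E' v = v ^ m * (g v - g 0)], which is
     at most [eps / 2 * w ^ m] in absolute value on [0, w]. *)
  set (E := fun v => D v - g 0 / INR (S m) * v ^ S m).
  assert (HE : forall v, is_derive E v (v ^ m * (g v - g 0))).
  { intros v. unfold E.
    assert (H1 : is_derive (fun v => g 0 / INR (S m) * v ^ S m) v
                   (g 0 / INR (S m) * (INR (S m) * 1 * v ^ m))).
    { apply is_derive_scal. apply (is_derive_pow (fun v => v) (S m)).
      apply (is_derive_id (K := R_AbsRing)). }
    replace (v ^ m * (g v - g 0)) with
      (v ^ m * g v - g 0 / INR (S m) * (INR (S m) * 1 * v ^ m))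
      by (field; exact Hm).
    apply (is_derive_minus (K := R_AbsRing) (V := R_NormedModule)); auto. }
  destruct (MVT_gen E 0 w (fun v => v ^ m * (g v - g 0))) as [z [Hz Ez]].
  - intros v _. apply HE.
  - intros v _. apply continuity_pt_filterlim.
    apply (ex_derive_continuous (K := R_AbsRing) (V := R_NormedModule)).
    eexists. apply HE.
  - rewrite Rmin_left, Rmax_right in Hz by lra.
    assert (E0 : E 0 = 0).
    { unfold E. rewrite D0, pow_i by lia. ring. }
    assert (Hgz : Rabs (g z - g 0) < eps / 2).
    { apply (Hdel z). change (Rabs (z - 0) < del).
      rewrite Rabs_pos_eq; lra. }
    assert (Hwm : 0 < w ^ m) by now apply pow_lt.
    assert (Hpos : 0 < w ^ S m) by now apply pow_lt.
    replace (D w / w ^ S m - g 0 / INR (S m)) with ((E w - E 0) / w ^ S m)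
      by (rewrite E0; unfold E; field; split; [exact Hm | lra]).
    rewrite Ez, Rabs_div, (Rabs_pos_eq (w ^ S m)) by lra.
    apply Rle_lt_trans with (eps / 2); [|lra].
    apply Rle_div_l; [exact Hpos|].
    rewrite !Rabs_mult, Rminus_0_r, (Rabs_pos_eq w) by lra.
    rewrite (Rabs_pos_eq (z ^ m)) by (apply pow_le; lra).
    assert (z ^ m <= w ^ m) by (apply pow_incr; lra).
    assert (0 <= z ^ m) by (apply pow_le; lra).
    pose proof (Rabs_pos (g z - g 0)).
    replace (eps / 2 * w ^ S m) with (w ^ m * (eps / 2) * w) by (simpl; ring).
    apply Rmult_le_compat_r; [lra|].
    apply Rmult_le_compat; lra.
Qed.

(** The coefficients of [Q' - P' Q], the numerator of the logarithmic derivative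
    of [Q exp (- P)]; they vanish when [Q] is a multiple of [exp P]. *)
Definition log_defect (p q : nat -> R) : nat -> R :=
  PS_minus (PS_derive q) (PS_mult (PS_derive p) q).

Lemma log_defect_entire (p q : nat -> R) :
  entire p -> entire q -> entire (log_defect p q).
Proof.
  intros Hp Hq. apply entire_minus; [now apply entire_derive|].
  apply entire_mult; [now apply entire_derive | exact Hq].
Qed.

(** [K - Q exp (- P)] vanishes at [0] and has derivative
    [- exp (- P) (Q' - P' Q)], which is [w ^ m] times a continuous function with
    value [- exp (- p 0) * log_defect p q m] at [0].  Multiplying by [exp P]
    gives back [K exp P - Q]. *)
Lemma lim_exp_minus_series_next (K : R) (p q : nat -> R) (m : nat) :
  entire p -> entire q -> K * exp (p 0%nat) = q 0%nat ->
  (forall n, (n < m)%nat -> log_defect p q n = 0) ->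
  filterlim (fun w => (K * exp (PSeries p w) - PSeries q w) / w ^ S m)
    (at_right 0) (locally (- log_defect p q m / INR (S m))).
Proof.
  intros Hp Hq H0 Hm.
  assert (Ht := log_defect_entire p q Hp Hq).
  set (t := log_defect p q) in *.
  set (D := fun w => K - PSeries q w * exp (- PSeries p w)).
  set (g := fun w => - exp (- PSeries p w) * PSeries (PS_decr_n t m) w).
  assert (He : forall w, exp (PSeries p w) * exp (- PSeries p w) = 1).
  { intros w. rewrite <- exp_plus, Rplus_opp_r. apply exp_0. }
  assert (HDg : filterlim (fun w => D w / w ^ S m) (at_right 0)
                  (locally (g 0 / INR (S m)))).
  { apply lim_quotient_of_derivative.
    - unfold D. rewrite !PSeries_0, <- H0, Rmult_assoc, <- exp_plus.
      rewrite Rplus_opp_r, exp_0. ring.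
    - intros w. unfold D, g.
      replace (w ^ m * (- exp (- PSeries p w) * PSeries (PS_decr_n t m) w))
        with (- exp (- PSeries p w) * (w ^ m * PSeries (PS_decr_n t m) w))
        by ring.
      rewrite <- (PSeries_decr_n_aux t m w Hm).
      unfold t, log_defect.
      rewrite PSeries_minus, PSeries_mult;
        try (apply entire_CV_radius; auto using entire_derive);
        try (revert w; change (entire (PS_derive q)); now apply entire_derive);
        try (apply entire_mult; auto using entire_derive).
      pose proof (is_derive_entire p w Hp) as Dp.
      pose proof (is_derive_entire q w Hq) as Dq.
      auto_derive.
      + repeat split; eexists; eassumption.
      + rewrite (is_derive_unique _ _ _ Dp : Derive (fun v : R => PSeries p v) w = _).
        rewrite (is_derive_unique _ _ _ Dq : Derive (fun v : R => PSeries q v) w = _). ring.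
    - apply (continuous_mult (K := R_AbsRing)).
      + apply (continuous_opp (V := R_NormedModule)).
        apply continuous_comp with (f := fun w => - PSeries p w).
        * apply (continuous_opp (V := R_NormedModule)).
          now apply entire_continuous.
        * apply continuous_exp.
      + now apply entire_continuous, entire_decr_n. }
  assert (Hexp : filterlim (fun w => exp (PSeries p w)) (at_right 0)
                   (locally (exp (PSeries p 0)))).
  { apply (filterlim_at_right_continuous (fun w => exp (PSeries p w))).
    apply continuous_comp; [now apply entire_continuous|apply continuous_exp]. }
  replace (- t m / INR (S m))
    with (mult (g 0 / INR (S m)) (exp (PSeries p 0))).
  - eapply filterlim_ext.
    2: exact (filterlim_comp_2 _ _ mult HDg Hexp
                (filterlim_mult (K := R_AbsRing) _ _)).
    intros w. cbv beta. unfold mult; simpl mult. unfold D, Rdiv.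
    transitivity ((K * exp (PSeries p w) -
       PSeries q w * (exp (PSeries p w) * exp (- PSeries p w))) * / w ^ S m).
    + simpl. ring.
    + rewrite He. simpl. ring.
  - unfold mult; simpl mult. unfold g. rewrite (PSeries_0 (PS_decr_n t m)).
    unfold PS_decr_n. rewrite Nat.add_0_r.
    transitivity (- t m / INR (S m) *
                  (exp (PSeries p 0) * exp (- PSeries p 0))).
    + unfold Rdiv. simpl. ring.
    + rewrite He. apply Rmult_1_r.
Qed.

(** By induction on [m]: once the remainder is [o(w ^ m)], its quotient by
    [w ^ (m+1)] has a limit proportional to the next coefficient of the
    logarithmic defect, so it is [o(w ^ (m+1))] exactly if that coefficient
    is zero. *)
Lemma lim_exp_minus_series_iff (K : R) (p q : nat -> R) (m : nat) :
  entire p -> entire q ->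
  filterlim (fun w => (K * exp (PSeries p w) - PSeries q w) / w ^ m)
    (at_right 0) (locally 0) <->
  K * exp (p 0%nat) = q 0%nat /\
  (forall n, (n < m)%nat -> log_defect p q n = 0).
Proof.
  intros Hp Hq.
  assert (Hlim0 : filterlim
    (fun w => (K * exp (PSeries p w) - PSeries q w) / w ^ 0)
    (at_right 0) (locally (K * exp (p 0%nat) - q 0%nat))).
  { rewrite <- (PSeries_0 p), <- (PSeries_0 q).
    apply filterlim_ext with (fun w => K * exp (PSeries p w) - PSeries q w).
    { intros w. simpl. symmetry. apply Rdiv_1_r. }
    apply (filterlim_at_right_continuous
             (fun w => K * exp (PSeries p w) - PSeries q w)).
    apply (continuous_minus (V := R_NormedModule)).
    - apply (continuous_mult (K := R_AbsRing)); [apply continuous_const|].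
      apply continuous_comp; [now apply entire_continuous|apply continuous_exp].
    - now apply entire_continuous. }
  induction m as [|m IH].
  - split.
    + intros H. split; [|intros n Hn; lia].
      pose proof (at_right_unique _ _ _ _ H Hlim0). lra.
    + intros [H _]. rewrite H, Rminus_diag in Hlim0. exact Hlim0.
  - split.
    + intros H.
      assert (Hm : filterlim
        (fun w => (K * exp (PSeries p w) - PSeries q w) / w ^ m)
        (at_right 0) (locally 0)).
      { assert (Hid : filterlim (fun w : R => w) (at_right 0) (locally 0))
          by apply (filterlim_at_right_continuous (fun w => w)),
                   continuous_id.
        replace 0 with (mult 0 0 : R) at 2 by apply Rmult_0_l.
        eapply filterlim_within_ext.
        2: exact (filterlim_comp_2 _ _ mult H Hid
                    (filterlim_mult (K := R_AbsRing) _ _)).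
        intros w Hw. unfold mult; simpl. field.
        split; [apply pow_nonzero|]; lra. }
      apply IH in Hm. destruct Hm as [H0 Hn]. split; [exact H0|].
      intros n Hlt. destruct (Nat.eq_dec n m) as [->|Hne]; [|apply Hn; lia].
      pose proof (lim_exp_minus_series_next K p q m Hp Hq H0 Hn) as HL.
      pose proof (at_right_unique _ _ _ _ H HL) as E.
      assert (INR (S m) <> 0) by now apply not_0_INR.
      apply Rmult_eq_reg_r with (- / INR (S m)).
      * rewrite Rmult_0_l, E. unfold Rdiv. ring.
      * now apply Ropp_neq_0_compat, Rinv_neq_0_compat.
    + intros [H0 Hn].
      assert (HL : filterlim
        (fun w => (K * exp (PSeries p w) - PSeries q w) / w ^ S m)
        (at_right 0) (locally (- log_defect p q m / INR (S m))))
        by (apply lim_exp_minus_series_next; auto).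
      rewrite (Hn m) in HL by lia.
      now rewrite Ropp_0, Rdiv_0_l in HL.
Qed.

(** * The coefficients of the equation *)

(** With [a], [b], [d] the values at [x] of the [G k] and of their first and
    second derivatives: the coefficients of the argument [P] of the exponential,
    without its logarithmic and constant terms, which contribute the factor
    [exp (-1) / w]. *)
Definition exponent_coef (a b : nat -> R) : nat -> R :=
  PS_plus (PS_scal (-8) (PS_derive a)) (PS_scal (-4) b).

(** The coefficients of [w (d_x d_w F)^2 - w (d_w^2 F) (d_x^2 F)]; the term [/ 8]
    comes from the second derivative [/ (8 w)] of the logarithmic part. *)
Definition rest_coef (a b d : nat -> R) : nat -> R :=
  PS_minus (PS_incr_1 (PS_mult (PS_derive b) (PS_derive b)))
    (PS_plus (PS_scal (/ 8) d)
       (PS_mult (PS_incr_1 (PS_derive (PS_derive a))) d)).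

Definition residual (a b d : nat -> R) : nat -> R :=
  log_defect (exponent_coef a b) (rest_coef a b d).

Lemma PS_mult_ext_loc (a a' b b' : nat -> R) (n : nat) :
  (forall k, (k <= n)%nat -> a k = a' k) ->
  (forall k, (k <= n)%nat -> b k = b' k) ->
  PS_mult a b n = PS_mult a' b' n.
Proof.
  intros Ha Hb. apply sum_eq. intros i Hi. rewrite Ha, Hb by lia. reflexivity.
Qed.

Lemma PS_mult_diff_top (a a' b b' : nat -> R) (n : nat) :
  (forall k, (k < n)%nat -> a k = a' k) ->
  (forall k, (k <= n)%nat -> b k = b' k) ->
  PS_mult a b n - PS_mult a' b' n = (a n - a' n) * b 0%nat.
Proof.
  intros Ha Hb. destruct n as [|n]; unfold PS_mult.
  - simpl. rewrite (Hb 0%nat) by lia. ring.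
  - rewrite !tech5, Nat.sub_diag, <- (Hb 0%nat) by lia.
    rewrite (sum_eq _ (fun k => a' k * b' (S n - k)%nat) n).
    + ring.
    + intros i Hi. rewrite Ha, Hb by lia. reflexivity.
Qed.

Lemma rest_coef_0 (a b d : nat -> R) : rest_coef a b d 0%nat = - / 8 * d 0%nat.
Proof.
  unfold rest_coef, PS_minus, PS_plus, PS_scal, PS_opp, PS_mult, PS_incr_1.
  unfold minus, plus, opp, scal, zero; simpl; unfold mult; simpl. ring.
Qed.

Lemma exponent_coefE (a b : nat -> R) (n : nat) :
  exponent_coef a b n = - 8 * (INR (S n) * a (S n)) + - 4 * b n.
Proof. reflexivity. Qed.

Lemma rest_coef_S (a b d : nat -> R) (n : nat) :
  rest_coef a b d (S n) =
  PS_mult (PS_derive b) (PS_derive b) n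
  - (/ 8 * d (S n) + PS_mult (PS_incr_1 (PS_derive (PS_derive a))) d (S n)).
Proof.
  unfold rest_coef, PS_minus, PS_plus, PS_scal, PS_opp.
  unfold minus, plus, opp, scal; simpl; unfold mult; simpl. reflexivity.
Qed.

Lemma exponent_coef_ext (a b a' b' : nat -> R) (n : nat) :
  (forall k, (k <= S n)%nat -> a k = a' k) ->
  (forall k, (k <= n)%nat -> b k = b' k) ->
  exponent_coef a b n = exponent_coef a' b' n.
Proof.
  intros Ha Hb. rewrite !exponent_coefE, Ha, Hb by lia. reflexivity.
Qed.

(** The top coefficient [a (n+2)] enters only through the factor
    [w d_w^2 F], at order [w ^ (n+1)], where it is multiplied by [d 0]. *)
Lemma rest_coef_diff_top (a b d a' b' d' : nat -> R) (n : nat) :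
  (forall k, (k <= S n)%nat -> a k = a' k) ->
  (forall k, (k <= S n)%nat -> b k = b' k) ->
  (forall k, (k <= S n)%nat -> d k = d' k) ->
  rest_coef a b d (S n) - rest_coef a' b' d' (S n) =
  - (INR (S n) * INR (S (S n)) * d 0%nat * (a (S (S n)) - a' (S (S n)))).
Proof.
  intros Ha Hb Hd. rewrite !rest_coef_S.
  rewrite (PS_mult_ext_loc (PS_derive b) (PS_derive b')
             (PS_derive b) (PS_derive b') n)
    by (intros k Hk; unfold PS_derive; rewrite Hb by lia; reflexivity).
  rewrite (Hd (S n)) by lia.
  pose proof (PS_mult_diff_top
                (PS_incr_1 (PS_derive (PS_derive a)))
                (PS_incr_1 (PS_derive (PS_derive a'))) d d' (S n)) as E.
  assert (E1 : forall k, (k < S n)%nat ->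
    PS_incr_1 (PS_derive (PS_derive a)) k =
    PS_incr_1 (PS_derive (PS_derive a')) k).
  { intros [|k] Hk; [reflexivity|].
    unfold PS_incr_1, PS_derive. rewrite Ha by lia. reflexivity. }
  specialize (E E1 Hd).
  assert (E2 : forall v : nat -> R,
    PS_incr_1 (PS_derive (PS_derive v)) (S n) =
    INR (S n) * (INR (S (S n)) * v (S (S n)))) by reflexivity.
  rewrite (E2 a), (E2 a') in E.
  unfold Rminus in *.
  assert (forall u v w z, u + - v = z -> w + - (/ 8 * d' (S n) + u)
            + - (w + - (/ 8 * d' (S n) + v)) = - z) as L by (intros; lra).
  rewrite (L _ _ _ _ E). ring.
Qed.

Lemma rest_coef_ext (a b d a' b' d' : nat -> R) (n : nat) :
  (forall k, (k <= S n)%nat -> a k = a' k) ->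
  (forall k, (k <= n)%nat -> b k = b' k) ->
  (forall k, (k <= n)%nat -> d k = d' k) ->
  rest_coef a b d n = rest_coef a' b' d' n.
Proof.
  intros Ha Hb Hd. destruct n as [|n].
  - rewrite !rest_coef_0, Hd by lia. reflexivity.
  - apply Rminus_diag_uniq. rewrite rest_coef_diff_top by auto with arith.
    rewrite Ha by lia. ring.
Qed.

(** The unknown [a (n+2)] occurs in [Q' - P' Q] at order [n] in two places: in
    [(n+1) q_(n+1)], with factor [- (n+1)^2 (n+2) d_0], and in
    [- (n+1) p_(n+1) q_0] with [p_(n+1) = - 8 (n+2) a_(n+2) - 4 b_(n+1)] and
    [q_0 = - d_0 / 8], with factor [- (n+1) (n+2) d_0].  They have the same sign,
    so the slope vanishes only with [d 0]. *)
Lemma residual_diff_top (a b d a' b' d' : nat -> R) (n : nat) :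
  (forall k, (k <= S n)%nat -> a k = a' k) ->
  (forall k, (k <= S n)%nat -> b k = b' k) ->
  (forall k, (k <= S n)%nat -> d k = d' k) ->
  residual a b d n - residual a' b' d' n =
  - (INR (S n) * INR (S (S n)) ^ 2 * d 0%nat * (a (S (S n)) - a' (S (S n)))).
Proof.
  intros Ha Hb Hd.
  pose proof (rest_coef_diff_top a b d a' b' d' n Ha Hb Hd) as EQ.
  assert (EP : exponent_coef a b (S n) - exponent_coef a' b' (S n) =
               - 8 * INR (S (S n)) * (a (S (S n)) - a' (S (S n)))).
  { rewrite !exponent_coefE, (Hb (S n)) by lia. ring. }
  pose proof (PS_mult_diff_top
    (PS_derive (exponent_coef a b)) (PS_derive (exponent_coef a' b'))
    (rest_coef a b d) (rest_coef a' b' d') n) as EM.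
  assert (E1 : forall k, (k < n)%nat -> PS_derive (exponent_coef a b) k =
                                  PS_derive (exponent_coef a' b') k).
  { intros k Hk. unfold PS_derive.
    rewrite (exponent_coef_ext a b a' b') by (intros; auto with zarith).
    reflexivity. }
  assert (E2 : forall k, (k <= n)%nat ->
            rest_coef a b d k = rest_coef a' b' d' k).
  { intros k Hk. apply rest_coef_ext; intros; auto with zarith. }
  specialize (EM E1 E2). rewrite rest_coef_0 in EM.
  assert (E3 : forall v : nat -> R,
    PS_derive v n = INR (S n) * v (S n)) by reflexivity.
  rewrite (E3 (exponent_coef a b)), (E3 (exponent_coef a' b')) in EM.
  unfold residual, log_defect.
  change (PS_derive (rest_coef a b d) n
          - PS_mult (PS_derive (exponent_coef a b)) (rest_coef a b d) n
          - (PS_derive (rest_coef a' b' d') n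
             - PS_mult (PS_derive (exponent_coef a' b')) (rest_coef a' b' d') n)
          = - (INR (S n) * INR (S (S n)) ^ 2 * d 0%nat
               * (a (S (S n)) - a' (S (S n))))).
  rewrite (E3 (rest_coef a b d)), (E3 (rest_coef a' b' d')).
  transitivity
    (INR (S n) * (rest_coef a b d (S n) - rest_coef a' b' d' (S n))
     - (INR (S n) * exponent_coef a b (S n)
        - INR (S n) * exponent_coef a' b' (S n)) * (- / 8 * d 0%nat)).
  - rewrite <- EM. ring.
  - rewrite EQ, <- Rmult_minus_distr_l, EP.
    rewrite (S_INR (S n)). field.
Qed.

Lemma entire_exponent_coef (a b : nat -> R) :
  entire a -> entire b -> entire (exponent_coef a b).
Proof.
  intros Ha Hb.
  apply entire_plus; apply entire_scal; auto using entire_derive.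
Qed.

Lemma entire_rest_coef (a b d : nat -> R) :
  entire a -> entire b -> entire d -> entire (rest_coef a b d).
Proof.
  intros Ha Hb Hd. apply entire_minus.
  - apply entire_incr_1, entire_mult; now apply entire_derive.
  - apply entire_plus; [now apply entire_scal|].
    apply entire_mult; [|exact Hd].
    now apply entire_incr_1, entire_derive, entire_derive.
Qed.

Lemma PSeries_exponent_coef (a b : nat -> R) (w : R) :
  entire a -> entire b ->
  PSeries (exponent_coef a b) w =
  - 8 * PSeries (PS_derive a) w - 4 * PSeries b w.
Proof.
  intros Ha Hb. unfold exponent_coef.
  rewrite PSeries_plus, !PSeries_scal
    by (apply entire_scal; auto using entire_derive).
  ring.
Qed.

Lemma PSeries_rest_coef (a b d : nat -> R) (w : R) :
  entire a -> entire b -> entire d ->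
  PSeries (rest_coef a b d) w =
  w * PSeries (PS_derive b) w ^ 2
  - (/ 8 + w * PSeries (PS_derive (PS_derive a)) w) * PSeries d w.
Proof.
  intros Ha Hb Hd. unfold rest_coef.
  assert (Hb' := entire_derive b Hb).
  assert (Ha' := entire_incr_1 _ (entire_derive _ (entire_derive a Ha))).
  rewrite PSeries_minus, PSeries_incr_1, PSeries_plus, PSeries_scal.
  - rewrite !PSeries_mult by now apply entire_CV_radius.
    rewrite PSeries_incr_1. ring.
  - now apply entire_scal.
  - now apply entire_mult.
  - now apply entire_incr_1, entire_mult.
  - apply entire_plus; [now apply entire_scal | now apply entire_mult].
Qed.

(** * The equation on truncated series *)

(** Truncated series are treated as power series with finitely many nonzero
    coefficients, so that termwise operations need no bookkeeping of the last
    index. *)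
Definition cut (N : nat) (a : nat -> R) (k : nat) : R :=
  if (k <=? N)%nat then a k else 0.

Lemma cut_low (N : nat) (a : nat -> R) (k : nat) :
  (k <= N)%nat -> cut N a k = a k.
Proof. intros H. unfold cut. now rewrite (proj2 (Nat.leb_le k N) H). Qed.

Lemma cut_high (N : nat) (a : nat -> R) (k : nat) :
  (N < k)%nat -> cut N a k = 0.
Proof. intros H. unfold cut. now rewrite (proj2 (Nat.leb_gt k N) H). Qed.

Lemma entire_cut (N : nat) (a : nat -> R) : entire (cut N a).
Proof. apply entire_finite with N. apply cut_high. Qed.

Lemma log_series_trunc_PSeries (G : nat -> R -> R) (N : nat) (x w : R) :
  log_series_trunc G N x w =
  / 8 * w * ln w + PSeries (cut N (fun k => G k x)) w.
Proof.
  unfold log_series_trunc. rewrite (PSeries_finite _ N) by apply cut_high.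
  rewrite Rplus_assoc. f_equal.
  unfold sum_n. rewrite (sum_Sn_m _ 0 N) by lia.
  change (G 0%nat x + sum_n_m (fun k => w ^ k * G k x) 1 N =
          cut N (fun k => G k x) 0%nat * w ^ 0 +
          sum_n_m (fun k => cut N (fun k => G k x) k * w ^ k) 1 N).
  rewrite cut_low, pow_O, Rmult_1_r by lia. f_equal.
  apply sum_n_m_ext_loc. intros k Hk. rewrite cut_low by lia.
  apply Rmult_comm.
Qed.

Lemma is_derive_PSeries_param
    (A B : nat -> R -> R) (N : nat) (x w : R) :
  (forall k y, (N < k)%nat -> A k y = 0) ->
  (forall k, is_derive (A k) x (B k x)) ->
  is_derive (fun y => PSeries (fun k => A k y) w) x
    (PSeries (fun k => B k x) w).
Proof.
  intros HA HB.
  assert (HB0 : forall k, (N < k)%nat -> B k x = 0).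
  { intros k Hk. rewrite <- (is_derive_unique _ _ _ (HB k)).
    rewrite (Derive_ext _ (fun _ => 0)) by (intros; now apply HA).
    apply Derive_const. }
  apply is_derive_ext with (fun y => sum_n (fun k => A k y * w ^ k) N).
  { intros y. symmetry. apply PSeries_finite. intros; now apply HA. }
  rewrite (PSeries_finite _ N) by exact HB0.
  apply (is_derive_sum_n (K := R_AbsRing) (V := R_NormedModule)
           (fun k y => A k y * w ^ k)).
  intros k _.
  apply is_derive_ext with (fun y => w ^ k * A k y); [intros; apply Rmult_comm|].
  rewrite Rmult_comm. now apply is_derive_scal.
Qed.

Lemma is_derive_cut (G : nat -> R -> R) (N k : nat) (x : R) :
  (forall k, ex_derive (G k) x) ->
  is_derive (fun y => cut N (fun j => G j y) k) x
    (cut N (fun j => Derive (G j) x) k).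
Proof.
  intros HG. unfold cut. destruct (k <=? N)%nat.
  - now apply Derive_correct.
  - apply (is_derive_const (K := R_AbsRing) (V := R_NormedModule)).
Qed.

Section Truncation.

Context (U : R -> Prop) (HU : open U) (G : nat -> R -> R) (N : nat).
Hypothesis HG : forall k x, U x -> ex_derive (G k) x.
Hypothesis HG2 : forall k x, U x -> ex_derive (Derive (G k)) x.

Let F := log_series_trunc G N.
Let a (x : R) := cut N (fun k => G k x).
Let b (x : R) := cut N (fun k => Derive (G k) x).
Let d (x : R) := cut N (fun k => Derive (Derive (G k)) x).

Lemma d_w_trunc (x w : R) :
  0 < w -> d_w F x w = / 8 * (ln w + 1) + PSeries (PS_derive (a x)) w.
Proof using.
  intros Hw. apply is_derive_unique.
  apply is_derive_ext with (fun s => / 8 * s * ln s + PSeries (a x) s).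
  { intros s. symmetry. apply log_series_trunc_PSeries. }
  apply (is_derive_plus (K := R_AbsRing) (V := R_NormedModule)).
  - auto_derive; [exact Hw|]. field. lra.
  - apply is_derive_entire, entire_cut.
Qed.

Lemma d_w_d_w_trunc (x w : R) :
  0 < w ->
  d_w (d_w F) x w = / (8 * w) + PSeries (PS_derive (PS_derive (a x))) w.
Proof using.
  intros Hw. apply is_derive_unique.
  apply is_derive_ext_loc with
    (fun s => / 8 * (ln s + 1) + PSeries (PS_derive (a x)) s).
  { generalize (open_gt 0 w Hw). apply filter_imp.
    intros s Hs. symmetry. now apply d_w_trunc. }
  apply (is_derive_plus (K := R_AbsRing) (V := R_NormedModule)).
  - auto_derive; [exact Hw|]. field. lra.
  - apply is_derive_entire, entire_derive, entire_cut.
Qed.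

Lemma d_x_trunc (x w : R) : U x -> d_x F x w = PSeries (b x) w.
Proof using HG.
  intros Hx. apply is_derive_unique.
  apply is_derive_ext with (fun y => / 8 * w * ln w + PSeries (a y) w).
  { intros y. symmetry. apply log_series_trunc_PSeries. }
  rewrite <- (Rplus_0_l (PSeries (b x) w)).
  apply (is_derive_plus (K := R_AbsRing) (V := R_NormedModule)).
  - apply (is_derive_const (K := R_AbsRing) (V := R_NormedModule)).
  - apply (is_derive_PSeries_param (fun k y => a y k) (fun k y => b y k) N).
    + intros k y. apply cut_high.
    + intros k. apply is_derive_cut. intros; now apply HG.
Qed.

Lemma d_x_d_x_trunc (x w : R) : U x -> d_x (d_x F) x w = PSeries (d x) w.
Proof using HU HG HG2.
  intros Hx. apply is_derive_unique.
  apply is_derive_ext_loc with (fun y => PSeries (b y) w).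
  { generalize (HU x Hx). apply filter_imp.
    intros y Hy. symmetry. now apply d_x_trunc. }
  apply (is_derive_PSeries_param (fun k y => b y k) (fun k y => d y k) N).
  - intros k y. apply cut_high.
  - intros k. apply (is_derive_cut (fun k => Derive (G k))).
    intros; now apply HG2.
Qed.

Lemma d_x_d_w_trunc (x w : R) :
  U x -> 0 < w -> d_x (d_w F) x w = PSeries (PS_derive (b x)) w.
Proof using HG.
  intros Hx Hw. apply is_derive_unique.
  apply is_derive_ext with
    (fun y => / 8 * (ln w + 1) + PSeries (PS_derive (a y)) w).
  { intros y. symmetry. now apply d_w_trunc. }
  rewrite <- (Rplus_0_l (PSeries (PS_derive (b x)) w)).
  apply (is_derive_plus (K := R_AbsRing) (V := R_NormedModule)).
  - apply (is_derive_const (K := R_AbsRing) (V := R_NormedModule)).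
  - apply (is_derive_PSeries_param (fun k y => PS_derive (a y) k)
             (fun k y => PS_derive (b y) k) N).
    + intros k y Hk. unfold PS_derive, a. rewrite cut_high by lia. ring.
    + intros k. apply is_derive_scal. apply is_derive_cut.
      intros; now apply HG.
Qed.

(** The derivative [/ 8 * (ln w + 1)] of the logarithmic term turns the
    exponential into [exp (-1) / w] times the exponential of a polynomial; the
    other singular term is the [/ (8 w)] in the second derivative.  Hence the
    overall factor [/ w]. *)
Lemma monge_ampere_trunc (c x w : R) :
  U x -> 0 < w ->
  monge_ampere c F x w =
  (c * x * exp (-1) * exp (PSeries (exponent_coef (a x) (b x)) w)
   - PSeries (rest_coef (a x) (b x) (d x)) w) / w.
Proof using HU HG HG2.
  intros Hx Hw. unfold monge_ampere.
  rewrite d_w_trunc, d_w_d_w_trunc, d_x_trunc, d_x_d_x_trunc, d_x_d_w_trunc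
    by assumption.
  rewrite PSeries_exponent_coef, PSeries_rest_coef by apply entire_cut.
  set (A' := PSeries (PS_derive (a x)) w).
  set (Bw := PSeries (b x) w).
  replace (- 8 * (/ 8 * (ln w + 1) + A') - 4 * Bw)
    with (- ln w + (-1 + (- 8 * A' - 4 * Bw))) by field.
  rewrite !exp_plus, exp_Ropp, exp_ln by exact Hw.
  field. lra.
Qed.

End Truncation.

(** The coefficients of order at most [m] involve only the [G k] with
    [k <= m + 2], so every truncation at [N >= m + 2] has the same ones. *)
Lemma solves_order_by_order_iff (c : R) (U : R -> Prop) (G : nat -> R -> R) :
  open U -> (forall k, smooth_on U (G k)) ->
  solves_order_by_order c U G <->
  forall x, U x ->
    c * x * exp (-1) * exp (- 8 * G 1%nat x - 4 * Derive (G 0%nat) x)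
      = - / 8 * Derive (Derive (G 0%nat)) x /\
    forall n, residual (fun k => G k x) (fun k => Derive (G k) x)
                (fun k => Derive (Derive (G k)) x) n = 0.
Proof.
  intros HU HG.
  set (a := fun x k => G k x).
  set (b := fun x k => Derive (G k) x).
  set (d := fun x k => Derive (Derive (G k)) x).
  assert (Hiff : forall m N x, U x -> (m + 2 <= N)%nat ->
    filterlim (fun w => monge_ampere c (log_series_trunc G N) x w / w ^ m)
      (at_right 0) (locally 0) <->
    c * x * exp (-1) * exp (- 8 * a x 1%nat - 4 * b x 0%nat)
      = - / 8 * d x 0%nat /\
    (forall n, (n < S m)%nat -> residual (a x) (b x) (d x) n = 0)).
  { intros m N x Hx HN.
    pose proof (lim_exp_minus_series_iff (c * x * exp (-1))
      (exponent_coef (cut N (a x)) (cut N (b x)))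
      (rest_coef (cut N (a x)) (cut N (b x)) (cut N (d x))) (S m)
      (entire_exponent_coef _ _ (entire_cut _ _) (entire_cut _ _))
      (entire_rest_coef _ _ _ (entire_cut _ _) (entire_cut _ _)
         (entire_cut _ _))) as HL.
    rewrite rest_coef_0, exponent_coefE, !cut_low in HL by lia.
    replace (- 8 * (INR 1 * a x 1%nat) + - 4 * b x 0%nat)
      with (- 8 * a x 1%nat - 4 * b x 0%nat) in HL by (simpl; ring).
    assert (Hres : forall n, (n < S m)%nat ->
      log_defect (exponent_coef (cut N (a x)) (cut N (b x)))
        (rest_coef (cut N (a x)) (cut N (b x)) (cut N (d x))) n =
      residual (a x) (b x) (d x) n).
    { intros n Hn. apply Rminus_diag_uniq.
      fold (residual (cut N (a x)) (cut N (b x)) (cut N (d x))).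
      rewrite (residual_diff_top (cut N (a x)) (cut N (b x)) (cut N (d x)))
        by (intros; apply cut_low; lia).
      rewrite (cut_low N (a x)) by lia. ring. }
    assert (Hfun : forall w, 0 < w ->
      (c * x * exp (-1) *
         exp (PSeries (exponent_coef (cut N (a x)) (cut N (b x))) w)
       - PSeries (rest_coef (cut N (a x)) (cut N (b x)) (cut N (d x))) w)
        / w ^ S m =
      monge_ampere c (log_series_trunc G N) x w / w ^ m).
    { intros w Hw.
      rewrite (monge_ampere_trunc U HU G N
        (fun k y Hy => HG k 1%nat y Hy) (fun k y Hy => HG k 2%nat y Hy)
        c x w Hx Hw).
      fold (a x) (b x) (d x). simpl. field.
      split; [|apply pow_nonzero]; lra. }
    split.
    - intros H.
      assert (H' : filterlim (fun w => (c * x * exp (-1) *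
         exp (PSeries (exponent_coef (cut N (a x)) (cut N (b x))) w)
         - PSeries (rest_coef (cut N (a x)) (cut N (b x)) (cut N (d x))) w)
        / w ^ S m) (at_right 0) (locally 0)).
      { eapply filterlim_within_ext; [|exact H].
        intros w Hw. symmetry. now apply Hfun. }
      apply HL in H'. destruct H' as [H0 Hn]. split; [exact H0|].
      intros n Hlt. rewrite <- Hres by exact Hlt. now apply Hn.
    - intros [H0 Hn].
      eapply filterlim_within_ext; [exact Hfun|].
      apply HL. split; [exact H0|].
      intros n Hlt. rewrite Hres by exact Hlt. now apply Hn. }
  split.
  - intros HS x Hx. split.
    + destruct (HS 0%nat x Hx) as [N HN].
      apply (Hiff 0%nat (N + 2)%nat x Hx); [lia|]. apply HN. lia.
    + intros n. destruct (HS n x Hx) as [N HN].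
      apply (Hiff n (N + n + 2)%nat x Hx); [lia| |lia]. apply HN. lia.
  - intros HE m x Hx. exists (m + 2)%nat. intros N HN.
    apply Hiff; [exact Hx|exact HN|].
    destruct (HE x Hx) as [H0 Hn]. split; auto.
Qed.

(** * Smooth functions *)

(** A class of functions containing the smooth ones, closed under the operations
    that the recursion uses and, because of the last constructor, under
    differentiation on [U].  A class of differentiable functions closed under
    differentiation consists of smooth functions, so no rule for iterated
    derivatives of products or inverses is needed. *)
Inductive smooth_expr (U : R -> Prop) : (R -> R) -> Prop :=
| se_smooth f : smooth_on U f -> smooth_expr U f
| se_const r : smooth_expr U (fun _ => r)
| se_id : smooth_expr U (fun x => x)
| se_plus f g : smooth_expr U f -> smooth_expr U g ->
    smooth_expr U (fun x => f x + g x)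
| se_mult f g : smooth_expr U f -> smooth_expr U g ->
    smooth_expr U (fun x => f x * g x)
| se_inv f : smooth_expr U f -> (forall x, U x -> f x <> 0) ->
    smooth_expr U (fun x => / f x)
| se_ln f : smooth_expr U f -> (forall x, U x -> 0 < f x) ->
    smooth_expr U (fun x => ln (f x))
| se_ext f g : smooth_expr U f -> (forall x, U x -> f x = g x) ->
    smooth_expr U g.

Lemma smooth_on_Derive (U : R -> Prop) (f : R -> R) :
  smooth_on U f -> smooth_on U (Derive f).
Proof.
  intros Hf n x Hx. destruct n as [|n]; [exact I|].
  apply ex_derive_ext with (2 := Hf (S (S n)) x Hx).
  intros y. symmetry. rewrite <- (Nat.add_1_r n).
  apply (Derive_n_comp f n 1 y).
Qed.

Lemma smooth_expr_Derive (U : R -> Prop) (f : R -> R) :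
  open U -> smooth_expr U f ->
  (forall x, U x -> ex_derive f x) /\ smooth_expr U (Derive f).
Proof.
  intros HU Hf.
  induction Hf as [f Hf|r| |f g Hf [Df Sf] Hg [Dg Sg]|f g Hf [Df Sf] Hg [Dg Sg]
                  |f Hf [Df Sf] H0|f Hf [Df Sf] H0|f g Hf [Df Sf] E].
  - split.
    + intros x Hx. exact (Hf 1%nat x Hx).
    + now apply se_smooth, smooth_on_Derive.
  - split.
    + intros x _. apply ex_derive_const.
    + apply se_ext with (fun _ => 0); [apply se_const|].
      intros x _. symmetry. apply Derive_const.
  - split.
    + intros x _. apply ex_derive_id.
    + apply se_ext with (fun _ => 1); [apply se_const|].
      intros x _. symmetry. apply Derive_id.
  - split.
    + intros x Hx.
      now apply (ex_derive_plus (K := R_AbsRing) (V := R_NormedModule)); auto.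
    + apply se_ext with (fun x => Derive f x + Derive g x);
        [now apply se_plus|].
      intros x Hx. symmetry. apply Derive_plus; auto.
  - split.
    + intros x Hx. apply ex_derive_mult; auto.
    + apply se_ext with (fun x => Derive f x * g x + f x * Derive g x);
        [apply se_plus; now apply se_mult|].
      intros x Hx. symmetry. apply Derive_mult; auto.
  - split.
    + intros x Hx. apply ex_derive_inv; auto.
    + apply se_ext with (fun x => -1 * (Derive f x * (/ f x * / f x))).
      * apply se_mult; [apply se_const|]. apply se_mult; [exact Sf|].
        apply se_mult; now apply se_inv.
      * intros x Hx. rewrite Derive_inv by auto. field. auto.
  - assert (DL : forall x, U x ->
              is_derive (fun y => ln (f y)) x (Derive f x * / f x)).
    { intros x Hx. apply (is_derive_comp ln f).
      - apply is_derive_ln. auto.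
      - apply Derive_correct. auto. }
    split.
    + intros x Hx. eexists. now apply DL.
    + apply se_ext with (fun x => Derive f x * / f x).
      * apply se_mult; [exact Sf|]. apply se_inv; [exact Hf|].
        intros x Hx. specialize (H0 x Hx). lra.
      * intros x Hx. symmetry. now apply is_derive_unique, DL.
  - assert (EL : forall x, U x -> locally x (fun y => f y = g y)).
    { intros x Hx. generalize (HU x Hx). now apply filter_imp. }
    split.
    + intros x Hx. apply ex_derive_ext_loc with f; auto.
    + apply se_ext with (Derive f); [exact Sf|].
      intros x Hx. apply Derive_ext_loc. auto.
Qed.

Lemma smooth_expr_smooth (U : R -> Prop) (f : R -> R) :
  open U -> smooth_expr U f -> smooth_on U f.
Proof.
  intros HU Hf.
  assert (HD : forall n, smooth_expr U (Derive_n f n)).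
  { induction n as [|n IH]; [exact Hf|].
    exact (proj2 (smooth_expr_Derive U _ HU IH)). }
  intros [|n] x Hx; [exact I|].
  exact (proj1 (smooth_expr_Derive U _ HU (HD n)) x Hx).
Qed.

Lemma smooth_expr_PS_mult (U : R -> Prop) (a b : R -> nat -> R) (n : nat) :
  (forall k, smooth_expr U (fun x => a x k)) ->
  (forall k, smooth_expr U (fun x => b x k)) ->
  smooth_expr U (fun x => PS_mult (a x) (b x) n).
Proof.
  intros Ha Hb. unfold PS_mult.
  assert (H : forall m, smooth_expr U
            (fun x => sum_f_R0 (fun k => a x k * b x (n - k)%nat) m)).
  { induction m as [|m IH]; simpl.
    - now apply se_mult.
    - apply se_plus; [exact IH|]. now apply se_mult. }
  apply H.
Qed.

Lemma smooth_expr_scal (U : R -> Prop) (r : R) (f : R -> R) :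
  smooth_expr U f -> smooth_expr U (fun x => r * f x).
Proof. apply se_mult, se_const. Qed.

Lemma smooth_expr_minus (U : R -> Prop) (f g : R -> R) :
  smooth_expr U f -> smooth_expr U g -> smooth_expr U (fun x => f x - g x).
Proof.
  intros Hf Hg. apply se_ext with (fun x => f x + -1 * g x).
  - apply se_plus; [exact Hf | now apply smooth_expr_scal].
  - intros x _. ring.
Qed.

Lemma smooth_expr_residual (U : R -> Prop) (G : nat -> R -> R) (n : nat) :
  (forall k, smooth_on U (G k)) ->
  smooth_expr U (fun x => residual (fun k => G k x)
    (fun k => Derive (G k) x) (fun k => Derive (Derive (G k)) x) n).
Proof.
  intros HG.
  assert (Ha : forall k, smooth_expr U (fun x => G k x))
    by (intros; apply se_smooth, HG).
  assert (Hb : forall k, smooth_expr U (fun x => Derive (G k) x))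
    by (intros; apply se_smooth, smooth_on_Derive, HG).
  assert (Hd : forall k, smooth_expr U (fun x => Derive (Derive (G k)) x))
    by (intros; apply se_smooth, smooth_on_Derive, smooth_on_Derive, HG).
  assert (Hq : forall k, smooth_expr U (fun x => rest_coef (fun k => G k x)
    (fun k => Derive (G k) x) (fun k => Derive (Derive (G k)) x) k)).
  { intros [|k].
    - apply se_ext with (fun x => - / 8 * Derive (Derive (G 0%nat)) x).
      + now apply smooth_expr_scal.
      + intros x _. symmetry. apply rest_coef_0.
    - eapply se_ext; [|intros x _; symmetry; apply rest_coef_S].
      apply smooth_expr_minus.
      + apply smooth_expr_PS_mult; intros j; now apply smooth_expr_scal.
      + apply se_plus; [now apply smooth_expr_scal|].
        apply smooth_expr_PS_mult; [|exact Hd].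
        intros [|j]; [exact (se_const U 0)|].
        now apply smooth_expr_scal, smooth_expr_scal. }
  apply smooth_expr_minus.
  - now apply smooth_expr_scal.
  - apply smooth_expr_PS_mult; [|exact Hq].
    intros k. apply smooth_expr_scal.
    apply se_plus; apply smooth_expr_scal; [now apply smooth_expr_scal|easy].
Qed.

(** * Recursive construction *)

(** [step n] receives a whole sequence [h], of which only the first [n + 1] terms
    are those of the sequence being built; the others are arbitrary elements
    of [P]. *)
Lemma course_of_values_sequence (A : Type) (P : A -> Prop) (a0 : A)
    (step : nat -> (nat -> A) -> A) :
  P a0 -> (forall n h, (forall k, P (h k)) -> P (step n h)) ->
  exists g : nat -> A, g 0%nat = a0 /\ (forall k, P (g k)) /\
    forall n, exists h, (forall k, P (h k)) /\
      (forall k, (k <= n)%nat -> h k = g k) /\ g (S n) = step n h.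
Proof.
  intros P0 Pstep.
  set (stage := fix stage (n : nat) : nat -> A :=
    match n with
    | 0%nat => fun _ => a0
    | S m => fun k => if (k <=? m)%nat then stage m k else step m (stage m)
    end).
  assert (HP : forall n k, P (stage n k)).
  { induction n as [|n IH]; intros k; simpl; [exact P0|].
    destruct (k <=? n)%nat; auto. }
  assert (Hst : forall n m k, (k <= n)%nat -> (n <= m)%nat ->
            stage m k = stage n k).
  { intros n m k Hk Hm. induction Hm as [|m Hm IH]; [reflexivity|].
    simpl. rewrite (proj2 (Nat.leb_le k m)) by lia. exact IH. }
  exists (fun n => stage n n). repeat split; [intros; apply HP|].
  intros n. exists (stage n). repeat split.
  - apply HP.
  - intros k Hk. now apply Hst.
  - change ((if (S n <=? n)%nat then stage n (S n) else step n (stage n))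
            = step n (stage n)).
    now rewrite (proj2 (Nat.leb_gt (S n) n)) by lia.
Qed.

(** For [n = 0], the solution [G 1] of
    [c x / e * exp (- 8 G 1 - 4 G0') = - G0'' / 8].  For [n = m + 1], a Newton step
    on the [m]-th residual: since the residual is affine in [G (m+2)], it leads
    to the root whatever the current value of [G (m+2)] is. *)
Definition next_coefficient (c : R) (G0 : R -> R) (n : nat)
    (G : nat -> R -> R) : R -> R :=
  match n with
  | 0%nat => fun x =>
      - / 8 * (ln (-1 * (Derive (Derive G0) x * / (8 * c * x)))
               + (1 + 4 * Derive G0 x))
  | S m => fun x =>
      G (S (S m)) x +
      residual (fun k => G k x) (fun k => Derive (G k) x)
        (fun k => Derive (Derive (G k)) x) m
      * / (INR (S m) * INR (S (S m)) ^ 2 * Derive (Derive G0) x)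
  end.

Lemma slope_neq_0 (n : nat) (d0 : R) :
  d0 <> 0 -> INR (S n) * INR (S (S n)) ^ 2 * d0 <> 0.
Proof.
  intros Hd. repeat apply Rmult_integral_contrapositive_currified; trivial;
    now apply not_0_INR.
Qed.

Lemma sign_condition_consequences (c x d0 : R) :
  c * x * d0 < 0 ->
  c * x <> 0 /\ d0 <> 0 /\ 0 < -1 * (d0 * / (8 * c * x)).
Proof.
  intros H.
  assert (Hcx : c * x <> 0) by (intros E; rewrite E in H; lra).
  split; [exact Hcx|]. split; [intros ->; lra|].
  assert (0 < (c * x) ^ 2) by (apply pow2_gt_0; exact Hcx).
  replace (-1 * (d0 * / (8 * c * x)))
    with (- (c * x * d0) * / (8 * (c * x) ^ 2)).
  - apply Rmult_lt_0_compat; [lra|]. apply Rinv_0_lt_compat. lra.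
  - field. split; intros ->; apply Hcx; ring.
Qed.

Lemma next_coefficient_smooth (c : R) (U : R -> Prop) (G0 : R -> R)
    (n : nat) (G : nat -> R -> R) :
  open U -> smooth_on U G0 ->
  (forall x, U x -> c * x * Derive (Derive G0) x < 0) ->
  (forall k, smooth_on U (G k)) ->
  smooth_on U (next_coefficient c G0 n G).
Proof.
  intros HU HG0 Hneg HG. apply smooth_expr_smooth; [exact HU|].
  assert (Hb := smooth_on_Derive U G0 HG0).
  assert (Hd := smooth_on_Derive U _ Hb).
  destruct n as [|n]; simpl next_coefficient.
  - apply smooth_expr_scal, se_plus.
    + apply se_ln.
      * apply smooth_expr_scal, se_mult; [now apply se_smooth|].
        apply se_inv; [apply smooth_expr_scal, se_id|].
        intros x Hx. destruct (sign_condition_consequences _ _ _ (Hneg x Hx)) as [H _].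
        intros E. apply H. lra.
      * intros x Hx. apply sign_condition_consequences, Hneg, Hx.
    + apply se_plus; [apply se_const|].
      now apply smooth_expr_scal, se_smooth.
  - apply se_plus; [apply se_smooth, HG|].
    apply se_mult; [now apply smooth_expr_residual|].
    apply se_inv; [now apply smooth_expr_scal, se_smooth|].
    intros x Hx. apply slope_neq_0. now apply (sign_condition_consequences c x), Hneg.
Qed.

(** * Existence and uniqueness *)

Lemma log_series_solution_exists (c : R) (U : R -> Prop) (G0 : R -> R) :
  open U -> smooth_on U G0 ->
  (forall x, U x -> c * x * Derive (Derive G0) x < 0) ->
  exists G : nat -> R -> R, log_series_solution c U G /\ G 0%nat = G0.
Proof.
  intros HU HG0 Hneg.
  destruct (course_of_values_sequence _ (smooth_on U) G0
              (next_coefficient c G0) HG0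
              (fun n h Hh => next_coefficient_smooth c U G0 n h HU HG0 Hneg Hh))
    as [G [E0 [HG Hstep]]].
  exists G. split; [|exact E0]. split; [exact HG|].
  apply solves_order_by_order_iff; [exact HU|exact HG|].
  intros x Hx.
  destruct (sign_condition_consequences _ _ _ (Hneg x Hx)) as [Hcx [Hd Hpos]].
  split.
  - destruct (Hstep 0%nat) as [h [_ [_ E1]]].
    rewrite E1, E0. simpl next_coefficient.
    (* [- 8 G 1 - 4 G0' = ln L + 1] with [L = - G0'' / (8 c x)]; the [1] cancels
       the factor [exp (-1)]. *)
    set (L := -1 * (Derive (Derive G0) x * / (8 * c * x))) in *.
    replace (- 8 * (- / 8 * (ln L + (1 + 4 * Derive G0 x))) - 4 * Derive G0 x)
      with (ln L + 1) by field.
    rewrite exp_plus, exp_ln by exact Hpos.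
    transitivity (c * x * L * (exp (-1) * exp 1)); [ring|].
    rewrite <- exp_plus. replace (-1 + 1) with 0 by ring.
    rewrite exp_0. unfold L. field.
    split; intros ->; apply Hcx; ring.
  - intros n. destruct (Hstep (S n)) as [h [_ [Eh EG]]].
    pose proof (residual_diff_top (fun k => h k x) (fun k => Derive (h k) x)
      (fun k => Derive (Derive (h k)) x) (fun k => G k x)
      (fun k => Derive (G k) x) (fun k => Derive (Derive (G k)) x) n) as E.
    specialize (E (fun k Hk => f_equal (fun f => f x) (Eh k Hk))
      (fun k Hk => f_equal (fun f => Derive f x) (Eh k Hk))
      (fun k Hk => f_equal (fun f => Derive (Derive f) x) (Eh k Hk))).
    cbv beta in E. rewrite EG in E.
    rewrite (Eh 0%nat), E0 in E by lia.
    cbn [next_coefficient] in E.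
    (* The correction in [next_coefficient] makes the difference of the two
       residuals equal to that of [h], so that of [G] is zero. *)
    match type of E with ?r - ?s = _ => assert (E' : r - s = r) end.
    { rewrite E. field. repeat split; try now apply not_0_INR. exact Hd. }
    lra.
Qed.

Lemma Derive_eq_on_open (V : R -> Prop) (f g : R -> R) :
  open V -> (forall x, V x -> f x = g x) ->
  forall x, V x -> Derive f x = Derive g x.
Proof.
  intros HV E x Hx. apply Derive_ext_loc.
  generalize (HV x Hx). now apply filter_imp.
Qed.

(** On the open set of the nonzero points of [U], agreement of the earlier
    coefficients passes to their derivatives; there the first relation shows that
    [G0''] does not vanish, as an exponential is not zero, so the slope of the
    next residual is not zero. *)
Lemma log_series_solution_unique_off_0 (c : R) (U : R -> Prop)
    (G H : nat -> R -> R) :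
  c <> 0 -> open U -> log_series_solution c U G -> log_series_solution c U H ->
  (forall x, U x -> G 0%nat x = H 0%nat x) ->
  forall k x, U x -> x <> 0 -> G k x = H k x.
Proof.
  intros hc HU [HG SG] [HH SH] E0.
  rewrite solves_order_by_order_iff in SG, SH by assumption.
  set (V := fun x => U x /\ x <> 0).
  assert (HV : open V).
  { apply open_and; [exact HU|]. apply open_neq. }
  intros k x Hx Hx0. revert x Hx Hx0.
  induction k as [k IH] using lt_wf_ind. intros x Hx Hx0.
  assert (Ea : forall j, (j < k)%nat -> forall y, V y -> G j y = H j y)
    by (intros j Hj y [Hy Hy0]; now apply IH).
  assert (Eb : forall j, (j < k)%nat -> forall y, V y ->
            Derive (G j) y = Derive (H j) y)
    by (intros j Hj; apply Derive_eq_on_open; auto).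
  assert (Ed : forall j, (j < k)%nat -> forall y, V y ->
            Derive (Derive (G j)) y = Derive (Derive (H j)) y)
    by (intros j Hj; apply Derive_eq_on_open; auto).
  assert (Vx : V x) by (split; assumption).
  destruct (SG x Hx) as [SG0 SGn]. destruct (SH x Hx) as [SH0 SHn].
  assert (HK : c * x * exp (-1) <> 0).
  { pose proof (exp_pos (-1)).
    repeat apply Rmult_integral_contrapositive_currified; trivial; lra. }
  destruct k as [|[|n]].
  - now apply E0.
  - rewrite <- (Ed 0%nat), <- (Eb 0%nat), <- SG0 in SH0 by (lia || exact Vx).
    apply Rmult_eq_reg_l in SH0; [|exact HK].
    apply exp_inv in SH0. lra.
  - pose proof (residual_diff_top (fun k => G k x) (fun k => Derive (G k) x)
      (fun k => Derive (Derive (G k)) x) (fun k => H k x)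
      (fun k => Derive (H k) x) (fun k => Derive (Derive (H k)) x) n) as E.
    cbv beta in E. rewrite SGn, SHn, Rminus_diag in E.
    assert (Hd : Derive (Derive (G 0%nat)) x <> 0).
    { intros Hd. rewrite Hd, Rmult_0_r in SG0.
      apply Rmult_integral in SG0. destruct SG0 as [F|F]; [now apply HK|].
      pose proof (exp_pos (- 8 * G 1%nat x - 4 * Derive (G 0%nat) x)). lra. }
    apply Rminus_diag_uniq.
    apply Rmult_eq_reg_l with (2 := slope_neq_0 n _ Hd).
    rewrite Rmult_0_r, <- (Ropp_involutive (_ * _)), <- E, Ropp_0; trivial;
      intros j Hj; [apply Ea|apply Eb|apply Ed]; (lia || exact Vx).
Qed.

Lemma eq_at_right_continuous (f g : R -> R) (a : R) :
  continuous f a -> continuous g a ->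
  at_right a (fun x => f x = g x) -> f a = g a.
Proof.
  intros Hf Hg E. apply (at_right_unique g a).
  - apply filterlim_ext_loc with (1 := E).
    now apply filterlim_at_right_continuous.
  - now apply filterlim_at_right_continuous.
Qed.

(** At [x = 0] the relations may leave a coefficient undetermined, but it is
    the limit of its values at nearby points of [U]. *)
Lemma log_series_solution_unique (c : R) (U : R -> Prop) (G H : nat -> R -> R) :
  c <> 0 -> open U -> log_series_solution c U G -> log_series_solution c U H ->
  (forall x, U x -> G 0%nat x = H 0%nat x) ->
  forall k x, U x -> G k x = H k x.
Proof.
  intros hc HU SG SH E0 k x Hx.
  assert (Hcont : forall F, log_series_solution c U F -> continuous (F k) x).
  { intros F [HF _].
    apply (ex_derive_continuous (K := R_AbsRing) (V := R_NormedModule)).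
    exact (HF k 1%nat x Hx). }
  destruct (Req_dec x 0) as [->|Hx0].
  - apply eq_at_right_continuous; auto.
    unfold at_right, within. generalize (HU 0 Hx).
    apply filter_imp. intros y Hy Hy0.
    apply (log_series_solution_unique_off_0 c U); auto. lra.
  - now apply (log_series_solution_unique_off_0 c U).
Qed.

(** * Freedom of the leading coefficient *)

Theorem mainTheorem5 (c : R) (U : R -> Prop) (hc : c <> 0) (hU : open U) :
  (forall G0 : R -> R,
     smooth_on U G0 ->
     (forall x : R, U x -> c * x * Derive_n G0 2 x < 0) ->
     exists G : nat -> R -> R,
       log_series_solution c U G /\ (forall x : R, U x -> G 0%nat x = G0 x))
  /\
  (forall G H : nat -> R -> R,
     log_series_solution c U G ->
     log_series_solution c U H ->
     (forall x : R, U x -> G 0%nat x = H 0%nat x) ->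
     forall (k : nat) (x : R), (1 <= k)%nat -> U x -> G k x = H k x).
Proof.
  split.
  - intros G0 HG0 Hneg.
    destruct (log_series_solution_exists c U G0 hU HG0 Hneg) as [G [SG E]].
    exists G. split; [exact SG|]. intros x _. now rewrite E.
  - intros G H SG SH E0 k x _ Hx.
    now apply (log_series_solution_unique c U).
Qed.
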